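(* Let $m\ge1$ and let $a$ be an integer with $2^{m-1}+1\leq a\leq 2^m$. Then $$B_a=\bigl(C_{2^m}\cap E_a(B_{2^m-a})\bigr)\cup\bigl(B_{2^m}\cap E_a(C_{2^m-a})\bigr),\qquad C_a=\bigl(B_{2^m}\cap E_a(B_{2^m-a})\bigr)\cup\bigl(C_{2^m}\cap E_a(C_{2^m-a})\bigr).$$
   Context: $\mathbb{N}_0=\{0,1,2,\dots\}$. $t(n)$ is the Thue–Morse sequence: $t(n)=0$ if the binary expansion of $n$ has an even number of $1$'s, $t(n)=1$ otherwise. For integers $a\ge0$, $B_a=\{x\in\mathbb{N}_0: t(x+a)=1-t(x)\}$ and $C_a=\{x\in\mathbb{N}_0: t(x+a)=t(x)\}$ (so $B_0=\emptyset$, $C_0=\mathbb{N}_0$). For a set of integers $A$ and $h\in\mathbb{Z}$, $E_h(A)=\{y-h: y\in A\}$. *)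

(* Defs.v *)
From HB Require Import structures.
From mathcomp Require Import all_boot all_order all_algebra.
From mathcomp Require Import classical_sets.
Set Implicit Arguments.
Unset Strict Implicit.
Unset Printing Implicit Defensive.
Import GRing.Theory.

Local Open Scope classical_set_scope.
Local Open Scope ring_scope.

Definition bindigit (n i : nat) : nat := ((n %/ 2 ^ i) %% 2)%N.

(* Since n < 2 ^ n, all the digits of n of index at least n are zero. *)
Definition binones (n : nat) : nat := (\sum_(i < n) (bindigit n i == 1))%N.

Definition thue_morse (n : nat) : nat := if odd (binones n) then 1%N else 0%N.

(* B_a and C_a consist of natural numbers, but they are viewed as sets of
   integers, because E_h does not preserve sets of natural numbers. The
   truncated subtraction of nat is harmless, as thue_morse takes values in
   {0, 1}. *)
Definition Bset (a : nat) : set int :=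
  [set x%:Z | x in [set x : nat | thue_morse (x + a) = (1 - thue_morse x)%N]].

Definition Cset (a : nat) : set int :=
  [set x%:Z | x in [set x : nat | thue_morse (x + a) = thue_morse x]].

Definition Eshift (h : int) (A : set int) : set int := [set y - h | y in A].

(* Main.v *)
Require Import Defs.
From HB Require Import structures.
From mathcomp Require Import all_boot all_order all_algebra.
From mathcomp Require Import classical_sets.
Set Implicit Arguments.
Unset Strict Implicit.
Unset Printing Implicit Defensive.
Import GRing.Theory.
Local Open Scope classical_set_scope.
Local Open Scope ring_scope.

(** Put [N] = 2^m. Going from x up to x + [N] and then down to x + a = x + [N] - ([N] - a), the
    value of t flips between x and x + a exactly when one of the two moves flips it, and is kept
    when both or neither do. Membership is thus a Boolean identity in the parities of [binones] at
    x, x + a and x + [N]. *)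

Lemma thue_morse_odd n : thue_morse n = odd (binones n).
Proof. by rewrite /thue_morse; case: odd. Qed.

Lemma Bset_natE (a x : nat) :
  Bset a x%:Z <-> odd (binones (x + a)%N) != odd (binones x).
Proof.
rewrite /Bset; split=> [[y /= + [<-]]|neq_odd].
  by rewrite !thue_morse_odd; do 2!case: odd.
by exists x => //=; rewrite !thue_morse_odd; move: neq_odd; do 2!case: odd.
Qed.

Lemma Cset_natE (a x : nat) :
  Cset a x%:Z <-> odd (binones (x + a)%N) == odd (binones x).
Proof.
rewrite /Cset; split=> [[y /= + [<-]]|eq_odd].
  by rewrite !thue_morse_odd; do 2!case: odd.
by exists x => //=; rewrite !thue_morse_odd (eqP eq_odd).
Qed.

Lemma EshiftE (h z : int) (A : set int) : Eshift h A z <-> A (z + h).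
Proof.
split=> [[y Ay <-]|Azh]; first by rewrite subrK.
by exists (z + h) => //; rewrite addrK.
Qed.

Lemma Bset_Negz (a n : nat) : ~ Bset a (Negz n).
Proof. by case. Qed.

Lemma Cset_Negz (a n : nat) : ~ Cset a (Negz n).
Proof. by case. Qed.

(* With y = x + a one has x + N = y + (N - a), so whether t(x) and t(x + a)
   agree is decided by comparing both of them with t(x + N). *)
Lemma BCset_decomposition (N a : nat) : (a <= N)%N ->
  Bset a = (Cset N `&` Eshift a%:Z (Bset (N - a)%N))
           `|` (Bset N `&` Eshift a%:Z (Cset (N - a)%N))
  /\
  Cset a = (Bset N `&` Eshift a%:Z (Bset (N - a)%N))
           `|` (Cset N `&` Eshift a%:Z (Cset (N - a)%N)).
Proof.
move=> le_aN; split; apply/seteqP; split=> -[x|n];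
  rewrite /setU /setI /= ?EshiftE -?PoszD;
  (* At a negative integer both sides are empty: [Eshift] may reach it, but every intersection also
     has an unshifted factor [Bset N] or [Cset N]. *)
  do ?[by move/Bset_Negz | by move/Cset_Negz
      | by case=> [] [] => [/Bset_Negz|/Cset_Negz]
      | by case=> [] [] => [/Cset_Negz|/Bset_Negz]];
  (* Since a <= [N], the sum x + a + ([N] - a) collapses to x + [N], leaving only three parities to
     enumerate. *)
  rewrite !(Bset_natE, Cset_natE) -addnA subnKC //;
  by do 3!case: odd; do ?case => //; do ?[by left | by right].
Qed.

Theorem theorem6 (m a : nat) (hm : (1 <= m)%N)
    (ha : (2 ^ (m - 1) + 1 <= a <= 2 ^ m)%N) :
  Bset a = (Cset (2 ^ m)%N `&` Eshift a%:Z (Bset (2 ^ m - a)%N))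
           `|` (Bset (2 ^ m)%N `&` Eshift a%:Z (Cset (2 ^ m - a)%N))
  /\
  Cset a = (Bset (2 ^ m)%N `&` Eshift a%:Z (Bset (2 ^ m - a)%N))
           `|` (Cset (2 ^ m)%N `&` Eshift a%:Z (Cset (2 ^ m - a)%N)).
Proof. by apply: BCset_decomposition; case/andP: ha. Qed.
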